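(* Let $\mathcal{A}$ be a unital $C^*$-algebra, $\mathcal{H}$ a Hilbert $\mathcal{A}$-module, and $\mathbb{J}\subseteq\mathbb{N}$ a finite or countable index set. For $n=1,2,\dots,k$, let $\{T_{n,i}\}_{i\in\mathbb{J}}\subset End_{\mathcal{A}}^{*}(\mathcal{H})$ be an operator frame for $End_{\mathcal{A}}^{*}(\mathcal{H})$ with bounds $A_n$ and $B_n$, and let $\{\alpha_n\}_{n=1}^{k}$ be any scalars. If there exist a constant $\lambda>0$ and some $p\in\{1,2,\dots,k\}$ such that $$\lambda\big\|\{T_{p,i}x\}_{i}\big\|\le\Big\|\Big\{\sum_{n=1}^{k}\alpha_nT_{n,i}x\Big\}_{i}\Big\|\qquad\text{for all }x\in\mathcal{H},$$ then $\big\{\sum_{n=1}^{k}\alpha_nT_{n,i}\big\}_{i\in\mathbb{J}}$ is an operator frame for $End_{\mathcal{A}}^{*}(\mathcal{H})$. Conversely, if $\big\{\sum_{n=1}^{k}\alpha_nT_{n,i}\big\}_{i\in\mathbb{J}}$ is an operator frame for $End_{\mathcal{A}}^{*}(\mathcal{H})$, then there exist a constant $\lambda>0$ and some $p\in\{1,2,\dots,k\}$ such that the displayed inequality holds.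
   Context: Hilbert $\mathcal{A}$-modules are left modules with $\mathcal{A}$-valued inner product $\langle\cdot,\cdot\rangle$, $\mathcal{A}$-linear in the first variable, with $\langle x,y\rangle=\langle y,x\rangle^*$, complete for $\|x\|=\|\langle x,x\rangle\|^{1/2}$. $End_{\mathcal{A}}^{*}(\mathcal{H})$ is the set of adjointable operators on $\mathcal{H}$. Inequalities between elements of $\mathcal{A}$ refer to the usual order given by the positive cone of $\mathcal{A}$. Scalars are complex numbers. A family $\{T_i\}_{i\in\mathbb{J}}\subset End_{\mathcal{A}}^{*}(\mathcal{H})$ is an operator frame for $End_{\mathcal{A}}^{*}(\mathcal{H})$ with (lower and upper) bounds $A,B>0$ if $A\langle x,x\rangle\le\sum_{i\in\mathbb{J}}\langle T_ix,T_ix\rangle\le B\langle x,x\rangle$ for all $x\in\mathcal{H}$; it is an operator frame if such constants exist. $\ell^2(\mathcal{H})$ is the Hilbert $\mathcal{A}$-module of sequences $\{x_i\}_{i\in\mathbb{J}}$ in $\mathcal{H}$ with $\sum_i\langle x_i,x_i\rangle$ norm convergent, and $\|\{x_i\}_i\|=\|\sum_{i}\langle x_i,x_i\rangle\|^{1/2}$. Convention: all series $\sum_{i\in\mathbb{J}}\langle T_ix,T_ix\rangle$ are taken to converge in norm in $\mathcal{A}$ (i.e. $\{T_ix\}_i\in\ell^2(\mathcal{H})$); this convergence is part of the notion of operator frame. *)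

(* Defs.v *)
From HB Require Import structures.
From mathcomp Require Import all_boot all_order all_algebra.
From mathcomp Require Import complex.
From mathcomp Require Import all_classical all_reals all_analysis.

Set Implicit Arguments.
Unset Strict Implicit.
Unset Printing Implicit Defensive.

Import Order.TTheory GRing.Theory Num.Theory numFieldNormedType.Exports.

Local Open Scope classical_set_scope.
Local Open Scope complex_scope.
Local Open Scope ring_scope.

(* The norm takes its values in the nonnegative reals of R[i].
   The library has no join of rings and normed modules other than its number
   structures, so the product is a field of the mixin, and the ring structure
   is put on the alias cstar_ring below.  The zero algebra is allowed. *)
HB.mixin Record isCStarAlgebra (R : realType) A
    of CompleteNormedModule R[i] A := {
  cunit : A ;
  cmul : A -> A -> A ;
  star : A -> A ;
  cmulA : associative cmul ;
  cmul1l : left_id cunit cmul ;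
  cmul1r : right_id cunit cmul ;
  cmulDl : left_distributive cmul +%R ;
  cmulDr : right_distributive cmul +%R ;
  cscaleAl : forall (c : R[i]) (a b : A), c *: cmul a b = cmul (c *: a) b ;
  cscaleAr : forall (c : R[i]) (a b : A), c *: cmul a b = cmul a (c *: b) ;
  starK : involutive star ;
  starD : {morph star : a b / a + b} ;
  starM : forall a b : A, star (cmul a b) = cmul (star b) (star a) ;
  starZ : forall (c : R[i]) (a : A), star (c *: a) = Num.conj c *: star a ;
  cstar_normM : forall a b : A, `|cmul a b| <= `|a| * `|b| ;
  cstar_identity : forall a : A, `|cmul (star a) a| = `|a| ^+ 2
}.

#[short(type="cstarAlgType")]
HB.structure Definition CStarAlgebra (R : realType) :=
  {A of CompleteNormedModule R[i] A & isCStarAlgebra R A}.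

Definition cstar_ring (R : realType) (A : cstarAlgType R) : Type := A.

HB.instance Definition _ (R : realType) (A : cstarAlgType R) :=
  GRing.Zmodule.on (cstar_ring A).

HB.instance Definition _ (R : realType) (A : cstarAlgType R) :=
  GRing.Zmodule_isPzRing.Build (cstar_ring A)
    (@cmulA R A) (@cmul1l R A) (@cmul1r R A) (@cmulDl R A) (@cmulDr R A).

Section Order.
Context {R : realType} {A : cstarAlgType R}.

Definition cstar_invertible (a : A) : Prop :=
  exists b : A, cmul a b = cunit /\ cmul b a = cunit.

Definition cstar_spectrum (a : A) : set R[i] :=
  [set z | ~ cstar_invertible (z *: cunit - a)].

(* In R[i], 0 <= z means that z is real and nonnegative. *)
Definition cstar_positive (a : A) : Prop :=
  star a = a /\ cstar_spectrum a `<=` [set z | 0 <= z].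

Definition cstar_le (a b : A) : Prop := cstar_positive (b - a).

End Order.

(* Completeness is stated by sequences, for the norm |<x, x>|^(1/2). *)
HB.mixin Record isHilbertModule (R : realType) (A : cstarAlgType R) H
    of GRing.Lmodule (cstar_ring A) H := {
  inner : H -> H -> A ;
  innerDZl : forall (a : cstar_ring A) (x y z : H),
    inner (a *: x + y) z = cmul a (inner x z) + inner y z ;
  innerC : forall x y : H, inner x y = star (inner y x) ;
  inner_pos : forall x : H, cstar_positive (inner x x) ;
  inner_eq0 : forall x : H, inner x x = 0 -> x = 0 ;
  hilbert_complete : forall u : nat -> H,
    (forall e : R[i], 0 < e -> exists N : nat, forall m n : nat,
      (N <= m)%N -> (N <= n)%N ->
      sqrtC `|inner (u m - u n) (u m - u n)| < e) ->
    exists l : H, forall e : R[i], 0 < e -> exists N : nat, forall n : nat,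
      (N <= n)%N -> sqrtC `|inner (u n - l) (u n - l)| < e
}.

#[short(type="hilbertModType")]
HB.structure Definition HilbertModule (R : realType) (A : cstarAlgType R) :=
  {H of GRing.Lmodule (cstar_ring A) H & isHilbertModule R A H}.

Section Frames.
Context {R : realType} {A : cstarAlgType R} {H : hilbertModType A}.

(* A complex scalar c acts on H as the element c 1 of the algebra. *)
Definition cscale (c : R[i]) (x : H) : H := (c *: (cunit : A) : cstar_ring A) *: x.

Definition adjointable : set (H -> H) :=
  [set T | exists S : H -> H, forall x y : H, inner (T x) y = inner x (S y)].

(* Index sets are subsets J of nat; families are functions on nat of which
   only the values on J matter. *)
Definition square_sums (J : set nat) (y : nat -> H) (n : nat) : A :=
  \sum_(0 <= i < n | i \in J) inner (y i) (y i).

Definition ell2 (J : set nat) : set (nat -> H) :=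
  [set y | cvgn (square_sums J y)].

Definition square_sum (J : set nat) (y : nat -> H) : A :=
  limn (square_sums J y).

Definition ell2_norm (J : set nat) (y : nat -> H) : R[i] :=
  sqrtC `|square_sum J y|.

Definition operator_frame_with (J : set nat) (T : nat -> H -> H)
    (a b : R) : Prop :=
  [/\ 0 < a, 0 < b,
      forall i, J i -> adjointable (T i) &
      forall x : H,
        [/\ ell2 J (fun i => T i x),
            cstar_le (a%:C *: inner x x) (square_sum J (fun i => T i x)) &
            cstar_le (square_sum J (fun i => T i x)) (b%:C *: inner x x)]].

Definition operator_frame (J : set nat) (T : nat -> H -> H) : Prop :=
  exists a b : R, operator_frame_with J T a b.

Definition lin_comb (k : nat) (alpha : 'I_k -> R[i])
    (T : 'I_k -> nat -> H -> H) : nat -> H -> H :=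
  fun i x => \sum_(n < k) cscale (alpha n) (T n i x).

End Frames.

(* Main.v *)
Require Import Defs.
From HB Require Import structures.
From mathcomp Require Import all_boot all_order all_algebra.
From mathcomp Require Import complex ring lra.
From mathcomp Require Import all_classical all_reals all_analysis.
Set Implicit Arguments.
Unset Strict Implicit.
Unset Printing Implicit Defensive.
Import Order.TTheory GRing.Theory Num.Theory numFieldNormedType.Exports.
Local Open Scope classical_set_scope.
Local Open Scope complex_scope.
Local Open Scope ring_scope.

(* The upper bound and the convergence follow from the parallelogram law.  For
   the lower bound, write g = <x, x> and h = sum_i <S_i x, S_i x>, where the S_i
   are the combined operators.  The norm inequality at the vectors a x, with a in
   the algebra, reads c |a g a^*| <= |a h a^*|.  At a = (h + eps)^(-1/2) the right
   side is at most 1, so c a g a <= 1, that is c g <= h + eps, and eps tends to 0.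

   This requires some order theory of the algebra, which is obtained without the
   spectral radius formula: a self-adjoint element is called positive when
   |t - a| <= t for some real t, square roots of 1 - y for |y| < 1 come from the
   iteration w -> (y + w^2) / 2, and for commuting self-adjoint x and y one has
   |x|^2 <= |x^2 + y^2| by the C*-identity for x + i y. *)

(** * Norm and square roots *)

Section RealAlgebra.
Context {R : realType} {A : cstarAlgType R}.
Local Notation B := (cstar_ring A).

(** Real scalars suffice for the order theory. Placing them on the ring alias lets sums, products
    and scalars of the algebra be handled together. *)
Definition real_scale (t : R) (a : B) : B := (t%:C *: (a : A))%R.

Lemma real_scaleA s t a : real_scale s (real_scale t a) = real_scale (s * t) a.
Proof. by rewrite /real_scale scalerA rmorphM. Qed.
Lemma real_scale1 : left_id 1 real_scale.
Proof. by move=> a; rewrite /real_scale rmorph1 scale1r. Qed.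
Lemma real_scaleDr : right_distributive real_scale +%R.
Proof. by move=> t a b; rewrite /real_scale scalerDr. Qed.
Lemma real_scaleDl a : {morph real_scale^~ a : s t / s + t}.
Proof. by move=> s t; rewrite /real_scale rmorphD scalerDl. Qed.

HB.instance Definition _ := GRing.Zmodule_isLmodule.Build R B
  real_scaleA real_scale1 real_scaleDr real_scaleDl.

Lemma real_scaleAl (t : R) (a b : B) : t *: (a * b) = (t *: a) * b.
Proof. exact: cscaleAl. Qed.
Lemma real_scaleAr (t : R) (a b : B) : t *: (a * b) = a * (t *: b).
Proof. exact: cscaleAr. Qed.

End RealAlgebra.

Section CStar.
Context {R : realType} {A : cstarAlgType R}.
Local Notation B := (cstar_ring A).
Implicit Types (a b x y : B) (t : R).

Definition adj a : B := star (a : A).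
(** The norm of [A] lies in [R[i]] but is real, so its real part loses nothing ([nrE]) and estimates
    take place in [R]. *)
Definition nr a : R := complex.Re `|a : A|.

Lemma nrE a : `|a : A| = (nr a)%:C.
Proof. by rewrite /nr RRe_real ?normr_real. Qed.

Lemma nr_ge0 a : 0 <= nr a.
Proof. by rewrite -ler0c -nrE. Qed.

Lemma nr0 : nr 0 = 0.
Proof. by rewrite /nr normr0. Qed.

Lemma nr_eq0 a : nr a = 0 -> a = 0.
Proof. by move=> h; apply/(@normr0_eq0 _ A); rewrite nrE h. Qed.

Lemma nrD a b : nr (a + b) <= nr a + nr b.
Proof. by rewrite -lecR rmorphD /= -!nrE; apply: (@ler_normD _ A). Qed.

Lemma nrN a : nr (- a) = nr a.
Proof. by rewrite /nr; congr complex.Re; apply: (@normrN _ A). Qed.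

Lemma nrC a b : nr (a - b) = nr (b - a).
Proof. by rewrite -nrN opprB. Qed.

Lemma nrZ t a : nr (t *: a) = `|t| * nr a.
Proof.
apply: complexI; rewrite rmorphM /= -!nrE.
rewrite -[LHS]/(`|t%:C *: (a : A)|) (@normrZ _ A); congr (_ * _).
by rewrite normc_def /= expr0n addr0 sqrtr_sqr.
Qed.

Lemma nrM a b : nr (a * b) <= nr a * nr b.
Proof. by rewrite -lecR rmorphM /= -!nrE; apply: (@cstar_normM R A). Qed.

Lemma nr_adjM a : nr (adj a * a) = nr a ^+ 2.
Proof. by apply: complexI; rewrite rmorphXn /= -!nrE; apply: (@cstar_identity R A). Qed.

Lemma adjK : involutive adj. Proof. exact: (@starK R A). Qed.
Lemma adjD a b : adj (a + b) = adj a + adj b. Proof. exact: (@starD R A). Qed.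
Lemma adjM a b : adj (a * b) = adj b * adj a. Proof. exact: (@starM R A). Qed.
Lemma adjZ t a : adj (t *: a) = t *: adj a.
Proof.
rewrite /adj -[X in star X]/(t%:C *: (a : A)) starZ.
by rewrite (CrealP _) // complex_real.
Qed.
Lemma adj0 : adj 0 = 0.
Proof. by apply: (addrI (adj 0)); rewrite -adjD !addr0. Qed.
Lemma adjN a : adj (- a) = - adj a.
Proof. by apply: (addrI (adj a)); rewrite -adjD !subrr adj0. Qed.
Lemma adjB a b : adj (a - b) = adj a - adj b.
Proof. by rewrite adjD adjN. Qed.
Lemma adj1 : adj 1 = 1.
Proof. by rewrite -[LHS]mulr1 -{2}[1]adjK -adjM mulr1 adjK. Qed.

(** From |a|^2 = |a* a| <= |a*| |a| one gets |a| <= |a*|; the same at a* gives equality. *)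
Lemma nr_adj a : nr (adj a) = nr a.
Proof.
wlog suff le : a / nr a <= nr (adj a).
  by apply/eqP; rewrite eq_le le -{2}[a]adjK le.
have [->|a0] := eqVneq (nr a) 0; first exact: nr_ge0.
have p : 0 < nr a by rewrite lt_neqAle eq_sym a0 nr_ge0.
by rewrite -(ler_pM2r p) -expr2 -nr_adjM nrM.
Qed.

Definition sa a := adj a = a.

Lemma nr_sqr_sa a : sa a -> nr (a * a) = nr a ^+ 2.
Proof. by move=> h; rewrite -nr_adjM h. Qed.

(** The C*-identity gives |1|^2 = |1|. Only an inequality is claimed, because |1| = 0 in the zero
    algebra. *)
Lemma nr1_le1 : nr 1 <= 1.
Proof.
have := nr_sqr_sa adj1; rewrite mulr1 => h.
have := nr_ge0 1; nra.
Qed.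

Lemma sa0 : sa 0. Proof. exact: adj0. Qed.
Lemma sa1 : sa 1. Proof. exact: adj1. Qed.
Lemma saD a b : sa a -> sa b -> sa (a + b).
Proof. by rewrite /sa adjD => -> ->. Qed.
Lemma saB a b : sa a -> sa b -> sa (a - b).
Proof. by rewrite /sa adjB => -> ->. Qed.
Lemma saZ t a : sa a -> sa (t *: a).
Proof. by rewrite /sa adjZ => ->. Qed.
Lemma saM a b : sa a -> sa b -> a * b = b * a -> sa (a * b).
Proof. by rewrite /sa adjM => -> -> ->. Qed.

(** Membership of [l] in the closure of [P]. Closed properties are stated through it, for fixed
    points and sums of series alike. *)
Definition adherent (P : B -> Prop) (l : B) :=
  forall e : R, 0 < e -> exists2 u, P u & nr (u - l) < e.

Lemma adherent_dist_le (c : B) t (P : B -> Prop) l :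
  adherent P l -> (forall u, P u -> nr (c - u) <= t) -> nr (c - l) <= t.
Proof.
move=> adh bound; apply/ler_addgt0Pr => e e0.
have [u Pu hu] := adh e e0.
rewrite -(subrKA u); apply: le_trans (nrD _ _) _.
by rewrite lerD ?bound// ltW.
Qed.

(** If f u = 0 then |f l| = |f (u - l)| <= k |u - l|. The uses are u* - u and v u - u v, whose
    kernels are the self-adjoint elements and the commutant of v. *)
Lemma adherent_ker (f : B -> B) (k : R) (P : B -> Prop) l :
  (forall u v, f (u - v) = f u - f v) -> (forall u, nr (f u) <= k * nr u) ->
  adherent P l -> (forall u, P u -> f u = 0) -> f l = 0.
Proof.
move=> fB fk adh f0; apply/nr_eq0/le_anti; rewrite nr_ge0 andbT.
apply/ler_addgt0Pr => e e0; rewrite add0r.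
have k1 : 0 < `|k| + 1 by rewrite ltr_wpDl.
have [u Pu hu] := adh (e / (`|k| + 1)) (divr_gt0 e0 k1).
rewrite -nrN -[- f l]add0r -(f0 u Pu) -fB (le_trans (fk _))//.
apply: (@le_trans _ _ ((`|k| + 1) * nr (u - l))).
  by apply: ler_wpM2r; rewrite ?nr_ge0//; have := ler_norm k; lra.
by rewrite mulrC -ler_pdivlMr// ltW.
Qed.

Lemma adherent_sa (P : B -> Prop) l :
  adherent P l -> (forall u, P u -> sa u) -> sa l.
Proof.
move=> adh Psa; apply/subr0_eq.
apply: (adherent_ker (f := fun u => adj u - u) (k := 2) _ _ adh) => [u v|u|u /Psa ->].
- by rewrite adjB !opprB addrACA [RHS]addrACA [- u + _]addrC.
- by rewrite (le_trans (nrD _ _))// nrN nr_adj mulrDl mul1r.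
- by rewrite subrr.
Qed.

Lemma adherent_comm (v : B) (P : B -> Prop) l :
  adherent P l -> (forall u, P u -> v * u = u * v) -> v * l = l * v.
Proof.
move=> adh Pc; apply/subr0_eq.
apply: (adherent_ker (f := fun u => v * u - u * v) (k := nr v + nr v) _ _ adh)
    => [u w|u|u /Pc ->].
- by rewrite mulrBr mulrBl !opprD addrACA.
- rewrite (le_trans (nrD _ _))// nrN mulrDl lerD ?nrM//.
  by rewrite [leRHS]mulrC nrM.
- by rewrite subrr.
Qed.

Lemma nr_complete (u : nat -> B) :
  (forall e : R, 0 < e -> exists N : nat, forall k, nr (u (N + k)%N - u N) < e) ->
  exists l, forall e : R, 0 < e ->
    exists N : nat, forall n, (N <= n)%N -> nr (u n - l) < e.
Proof.
move=> cau.
have cv : cvgn (u : nat -> A).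
  apply/cauchy_cvgP/cauchy_exP => e e0.
  have [e1 eE] : exists e1 : R, e = e1%:C.
    by exists (complex.Re e); rewrite RRe_real// gtr0_real.
  move: e0; rewrite eE ltcR => e0.
  have [N hN] := cau _ e0; exists (u N).
  exists N => // n /= Nn.
  rewrite -ball_normE /ball_ /= -[`|_|]/`|(u N - u n : B) : A| nrE ltcR nrC.
  by rewrite -(subnKC Nn).
exists (limn (u : nat -> A)) => e e0.
have /cvgrPdist_lt /(_ e%:C) := cv.
rewrite ltcR => /(_ e0) [N _ hN]; exists N => n Nn.
have := hN n Nn; rewrite /= -[`|_|]/`|(limn (u : nat -> A) - u n : B) : A|.
by rewrite nrE ltcR nrC.
Qed.

(** Banach's fixed point theorem for the iterates of [F] from 0. The invariant [P] plays two roles: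
    the contraction estimate is assumed only on it, and the fixed point inherits it. *)
Lemma contraction_fixpoint (F : B -> B) (rho : R) (P : B -> Prop) :
  0 <= rho < 1 -> P 0 -> (forall u, P u -> P (F u)) ->
  (forall u v, P u -> P v -> nr (F u - F v) <= rho * nr (u - v)) ->
  (forall l, adherent P l -> P l) ->
  exists2 w, P w & F w = w.
Proof.
move=> /andP[r0 r1] P0 PF Frho Pcl; pose u n := iter n F 0.
(* [K] solves K = rho K + |F 0|, so the ball of radius [K] contains all iterates. *)
have Pu n : P (u n) by elim: n => //= n; apply: PF.
pose K := nr (F 0) / (1 - rho).
have K0 : 0 <= K by rewrite divr_ge0 ?nr_ge0// subr_ge0 ltW.
have bnd n : nr (u n) <= K.
  elim: n => [|n IH]; first by rewrite nr0.
  have := nrD (F (u n) - F 0) (F 0); rewrite subrK /= => h.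
  have h1 := Frho _ _ (Pu n) P0; rewrite subr0 in h1.
  have h2 : K = rho * K + nr (F 0) by rewrite /K; field; lra.
  by rewrite h2 (le_trans h)// lerD2r (le_trans h1)// ler_wpM2l.
have geo n k : nr (u (n + k)%N - u n) <= rho ^+ n * K.
  elim: n => [|n IH]; first by rewrite subr0 expr0 mul1r.
  rewrite addSn /= (le_trans (Frho _ _ (Pu _) (Pu _)))//.
  by rewrite exprS -mulrA ler_wpM2l.
have [|w hw] := nr_complete (u := u).
  move=> e e0.
  have : (fun n => rho ^+ n) @ \oo --> (0 : R).
    by apply: cvg_expr; rewrite ger0_norm.
  move=> /cvgrPdist_lt /(_ (e / (K + 1))).
  have K1 : 0 < K + 1 by lra.
  rewrite divr_gt0// => /(_ isT) [N _ hN]; exists N => k.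
  have := hN N (leqnn N); rewrite /= sub0r normrN ger0_norm ?exprn_ge0//.
  rewrite ltr_pdivlMr// => h; apply: le_lt_trans (geo N k) _.
  by apply: le_lt_trans h; rewrite ler_wpM2l ?exprn_ge0//; lra.
have Pw : P w.
  by apply: Pcl => e /hw[N hN]; exists (u N) => //; apply: hN.
exists w => //; apply/subr0_eq/nr_eq0/le_anti; rewrite nr_ge0 andbT.
apply/ler_addgt0Pr => e e0; rewrite add0r.
have [N hN] := hw (e / 2) (divr_gt0 e0 (ltr0Sn R 1)).
have := hN N (leqnn N); have := hN N.+1 (leqnSn N); have := Frho _ _ Pw (Pu N).
have := nrD (F w - F (u N)) (u N.+1 - w); rewrite /= subrKA [nr (w - _)]nrC.
have := nr_ge0 (u N - w); nra.
Qed.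

(** The inverse is the fixed point of v -> 1 + y v. That equation alone gives a right inverse; the
    invariant y v = v y makes it two-sided. *)
Lemma neumann (y : B) : nr y < 1 ->
  exists2 v, v * (1 - y) = 1 & (1 - y) * v = 1.
Proof.
move=> y1.
have [] := @contraction_fixpoint (fun v => 1 + y * v) (nr y)
    (fun v => y * v = v * y).
- by rewrite nr_ge0.
- by rewrite mulr0 mul0r.
- by move=> u yu; rewrite mulrDr mulrDl mulr1 mul1r -mulrA yu.
- by move=> u v _ _; rewrite opprD addrACA subrr add0r -mulrBr nrM.
- by move=> l adh; apply: (adherent_comm adh).
move=> v yv vE; have h : v - y * v = 1 by rewrite -{1}vE addrK.
by exists v; rewrite ?mulrBr ?mulrBl ?mulr1 ?mul1r -?yv.
Qed.

(** A fixed point w of the iteration satisfies 2 w = y + w^2, that is (1 - w)^2 = 1 - y. On the ball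
    |w| <= |y| the map contracts by |y|, because u^2 - v^2 = u (u - v) + (u - v) v even without
    commutation. *)
Lemma sqrt_one_sub (y : B) : sa y -> nr y < 1 ->
  exists s, [/\ sa s, s * s = 1 - y & forall v, v * y = y * v -> v * s = s * v].
Proof.
move=> ysa y1; have y0 := nr_ge0 y.
have [] := @contraction_fixpoint (fun w => 2^-1 *: (y + w * w)) (nr y)
  (fun w => [/\ sa w, nr w <= nr y & forall v, v * y = y * v -> v * w = w * v]).
- by rewrite y0.
- by rewrite nr0; split=> //; [exact: sa0|move=> v _; rewrite mulr0 mul0r].
- move=> w [wsa wy wc]; split.
  + by apply/saZ/saD => //; apply: saM.
  + rewrite nrZ ger0_norm//; have := nrD y (w * w); have := nrM w w.
    have := nr_ge0 w; nra.
  + move=> v vy; rewrite -real_scaleAr -real_scaleAl mulrDr mulrDl vy.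
    by rewrite mulrA (wc v vy) -mulrA (wc v vy) mulrA.
- move=> u v [_ uy _] [_ vy _].
  rewrite -scalerBr opprD addrACA subrr add0r nrZ ger0_norm//.
  have -> : u * u - v * v = u * (u - v) + (u - v) * v.
    by rewrite mulrBr mulrBl addrA subrK.
  have := nrD (u * (u - v)) ((u - v) * v); have := nrM u (u - v).
  have := nrM (u - v) v; have := nr_ge0 (u - v).
  set d := nr (u - v) => d0; nra.
- move=> l adh; split.
  + by apply: (adherent_sa adh) => u [].
  + rewrite -nrN -sub0r; apply: (adherent_dist_le adh) => u [_ h _].
    by rewrite sub0r nrN.
  + by move=> v vy; apply: (adherent_comm adh) => u [_ _]; apply.
move=> w [wsa _ wc] wE; exists (1 - w); split.
- by apply: saB => //; exact: sa1.
- have {}wE : y + w * w = w + w.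
    by rewrite -[in RHS]wE -scalerDl (_ : 2^-1 + 2^-1 = 1 :> R) ?scale1r//; field.
  have {}wE : y = w + w - w * w by rewrite -wE addrK.
  by rewrite mulrBr mulr1 mulrBl mul1r wE !opprD !opprK !addrA.
- by move=> v vy; rewrite mulrBr mulrBl mulr1 mul1r wc.
Qed.

End CStar.

(** * Positive elements *)

Section Positive.
Context {R : realType} {A : cstarAlgType R}.
Local Notation B := (cstar_ring A).
Local Notation one := (1 : B).
Implicit Types (a b x y : B) (t : R).

(* Multiplication by ['i] is not available on [B], where only real scalars act. *)
Definition imul (y : B) : B := 'i *: (y : A).

Lemma imulAl y x : imul (y * x) = imul y * x.
Proof. exact: cscaleAl. Qed.
Lemma imulAr y x : imul (y * x) = y * imul x.
Proof. exact: cscaleAr. Qed.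
Lemma imulK y : imul (imul y) = - y.
Proof. by rewrite /imul scalerA -expr2 sqrCi scaleN1r. Qed.
Lemma adj_imul y : adj (imul y) = - imul (adj y).
Proof.
rewrite /adj /imul starZ (_ : Num.conj 'i = - 'i) ?scaleNr//.
exact: conjCi.
Qed.

(* The left-hand side is the norm of [x + i y] squared, and [x] is its real part. *)
Lemma nr_sqr_le x y : sa x -> sa y -> x * y = y * x ->
  nr x ^+ 2 <= nr (x * x + y * y).
Proof.
move=> xsa ysa xy; pose z := x + imul y.
have zs : adj z = x - imul y by rewrite adjD adj_imul xsa ysa.
have -> : x * x + y * y = adj z * z.
  rewrite zs mulrBl !mulrDr -imulAr -!imulAl -imulAr imulK xy opprD opprK.
  by rewrite addrA addrK.
rewrite nr_adjM lerXn2r ?nnegrE ?nr_ge0//.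
have -> : x = 2^-1 *: (z + adj z).
  rewrite zs addrACA subrr addr0 scalerDr -scalerDl.
  by rewrite (_ : 2^-1 + 2^-1 = 1 :> R) ?scale1r//; field.
rewrite nrZ ger0_norm//; have := nrD z (adj z); rewrite nr_adj; lra.
Qed.

Lemma nr_scalar t : 0 <= t -> nr (t *: (1 : B)) <= t.
Proof. by move=> t0; rewrite nrZ ger0_norm// ler_piMr// nr1_le1. Qed.

Lemma sa_scalar t : sa (t *: (1 : B)).
Proof. exact/saZ/sa1. Qed.

Lemma scalar_comm t a : t *: one * a = a * (t *: one).
Proof. by rewrite -real_scaleAl -real_scaleAr mul1r mulr1. Qed.

(* A spectrum-free form of positivity; see [cstar_positiveE]. *)
Definition npos a := sa a /\ exists t, nr (t *: one - a) <= t.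

Lemma npos_sa a : npos a -> sa a. Proof. by case. Qed.

Lemma nposD a b : npos a -> npos b -> npos (a + b).
Proof.
move=> [asa [s hs]] [bsa [t ht]]; split; first exact: saD.
exists (s + t); rewrite scalerDl opprD addrACA.
by rewrite (le_trans (nrD _ _))// lerD.
Qed.

Lemma nposZ t a : 0 <= t -> npos a -> npos (t *: a).
Proof.
move=> t0 [asa [s hs]]; split; first exact: saZ.
by exists (t * s); rewrite -scalerA -scalerBr nrZ ger0_norm// ler_wpM2l.
Qed.

Lemma npos_scalar t : 0 <= t -> npos (t *: one).
Proof.
by move=> t0; split; [exact: sa_scalar|exists t; rewrite subrr nr0].
Qed.

Lemma npos_scalarB t b : sa b -> nr b <= t -> npos (t *: one - b).
Proof.
move=> bsa bt; split; first by apply: saB => //; exact: sa_scalar.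
by exists t; rewrite opprB addrC subrK.
Qed.

(** Write a + e = (t + e) (1 - y) with y = (t - a) / (t + e). The shift by [e] makes |y| <= t / (t +
    e) < 1, so [sqrt_one_sub] applies to y. *)
Lemma npos_approx_sqrt a (e : R) : npos a -> 0 < e ->
  exists s, [/\ sa s, s * s = a + e *: one & forall v, v * a = a * v -> v * s = s * v].
Proof.
move=> [asa [t ht]] e0.
have t0 : 0 <= t := le_trans (nr_ge0 _) ht.
have te : 0 < t + e by lra.
pose y := (t + e)^-1 *: (t *: one - a).
have [||s [ssa sE sc]] := @sqrt_one_sub R A y.
- by apply/saZ/saB => //; exact: sa_scalar.
- rewrite nrZ ger0_norm ?invr_ge0 1?ltW// mulrC ltr_pdivrMr//; lra.
exists (Num.sqrt (t + e) *: s); split; first exact: saZ.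
  rewrite -real_scaleAl -real_scaleAr scalerA -(expr2 (Num.sqrt _)) sqr_sqrtr 1?ltW// sE.
  rewrite scalerBr scalerA divff ?gt_eqF// scale1r opprB scalerDl.
  by rewrite addrC addrA subrK addrC.
move=> v va; rewrite -real_scaleAl -real_scaleAr sc//.
by rewrite -real_scaleAl -real_scaleAr mulrBr mulrBl va -scalar_comm.
Qed.

(** For r < 1 let s^2 = 1 - r b^2. Then s commutes with b, and [nr_sqr_le] gives |1 - r b^2| = |s|^2
    <= |s^2 + r b^2| = |1| <= 1. The remaining term (1 - r) b^2 is small. *)
Lemma nr_one_sub_sqr b : sa b -> nr b <= 1 -> nr (1 - b * b) <= 1.
Proof.
move=> bsa b1; apply/ler_addgt0Pr => e e0.
have bb1 : nr (b * b) <= 1 by have := nr_ge0 b; rewrite nr_sqr_sa//; nra.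
pose r := (1 + e)^-1.
have r01 : 0 < r < 1 by rewrite invr_gt0 invf_lt1; lra.
have re : 1 - r <= e.
  have : r * (1 + e) = 1 by rewrite /r; field; lra.
  nra.
have [||s [ssa sE sc]] := @sqrt_one_sub R A (r *: (b * b)).
- exact/saZ/saM.
- rewrite nrZ gtr0_norm; have := nr_ge0 (b * b); nra.
have bs : s * (Num.sqrt r *: b) = Num.sqrt r *: b * s.
  rewrite -real_scaleAl -real_scaleAr sc//.
  by rewrite -real_scaleAl -real_scaleAr mulrA.
have h1 : nr (1 - r *: (b * b)) <= 1.
  rewrite -sE nr_sqr_sa// (le_trans (nr_sqr_le ssa (saZ _ bsa) bs))//.
  rewrite -real_scaleAl -real_scaleAr scalerA -(expr2 (Num.sqrt _)) sqr_sqrtr; last lra.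
  by rewrite sE subrK nr1_le1.
have -> : 1 - b * b = (1 - r *: (b * b)) - (1 - r) *: (b * b).
  by rewrite scalerBl scale1r opprB addrA subrK.
rewrite (le_trans (nrD _ _))// nrN lerD// nrZ ger0_norm; last lra.
by have := nr_ge0 (b * b); nra.
Qed.

Lemma nr_scalar_sub_sqr t b : sa b -> 0 < t -> nr b ^+ 2 <= t ->
  nr (t *: one - b * b) <= t.
Proof.
move=> bsa t0 bt; pose q := Num.sqrt t.
have qq : q * q = t by rewrite -expr2 sqr_sqrtr// ltW.
have q0 : 0 < q by rewrite sqrtr_gt0.
have -> : t *: one - b * b = t *: (1 - (q^-1 *: b) * (q^-1 *: b)).
  rewrite scalerBr -real_scaleAl -real_scaleAr !scalerA -invfM qq.
  by rewrite divff ?gt_eqF// scale1r.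
rewrite nrZ gtr0_norm// ler_piMr ?(ltW t0)//; apply: nr_one_sub_sqr; first exact: saZ.
rewrite nrZ gtr0_norm ?invr_gt0// mulrC ler_pdivrMr// mul1r.
by have := nr_ge0 b; nra.
Qed.

Lemma npos_sqr b : sa b -> npos (b * b).
Proof.
move=> bsa; split; first exact: saM.
exists (nr b ^+ 2 + 1); apply: nr_scalar_sub_sqr => //; have := nr_ge0 b; nra.
Qed.

(** The witness in [npos] may be any bound of the norm. With s^2 = a + e one has t - a = (t + e) -
    s^2 and |s|^2 <= t + e, so [nr_scalar_sub_sqr] applies. *)
Lemma npos_dist a t : npos a -> nr a <= t -> nr (t *: one - a) <= t.
Proof.
move=> ap at_le; apply/ler_addgt0Pr => e e0.
have [s [ssa sE _]] := npos_approx_sqrt ap e0.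
have -> : t *: one - a = (t + e) *: one - s * s.
  by rewrite sE scalerDl opprD addrACA subrr addr0.
have := nr_ge0 a => a0; apply: nr_scalar_sub_sqr => //; first lra.
rewrite -nr_sqr_sa// sE (le_trans (nrD _ _))// lerD//.
exact/nr_scalar/ltW.
Qed.

(** By [npos_dist] the single witness |l| + 1 serves all positive elements within distance 1 of [l],
    so the norm condition passes to the limit. *)
Lemma npos_adherent l : adherent npos l -> npos l.
Proof.
move=> adh; split; first by apply: (adherent_sa adh) => u /npos_sa.
exists (nr l + 1).
apply: (@adherent_dist_le _ _ _ _ (fun u => npos u /\ nr u <= nr l + 1)).
  move=> e e0; have m0 : 0 < Num.min e 1 by rewrite lt_min e0 ltr01.
  have [u up] := adh _ m0; rewrite lt_min => /andP[ue u1].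
  exists u => //; split=> //.
  by have := nrD l (u - l); rewrite addrC subrK; lra.
by move=> u [up ul]; apply: npos_dist.
Qed.

Lemma npos_eps a : (forall e : R, 0 < e -> npos (a + e *: one)) -> npos a.
Proof.
move=> h; apply: npos_adherent => e e0.
have e2 : 0 < e / 2 by lra.
exists (a + (e / 2) *: one); first exact: h.
rewrite addrAC subrr add0r (le_lt_trans (nr_scalar (ltW e2)))//; lra.
Qed.

(** Let s^2 = x + d and t^2 = y + d. The roots commute, so (s t)^2 is the square of a self-adjoint
    element, and it differs from x y by d (x + y + d). *)
Lemma nposM x y : npos x -> npos y -> x * y = y * x -> npos (x * y).
Proof.
move=> xp yp xy; apply: npos_adherent => e e0.
pose K := nr x + nr y + 1.
have K0 : 0 < K by have := nr_ge0 x; have := nr_ge0 y; rewrite /K; lra.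
(* d <= 1 gives |x + y + d| <= K, and d (K + 1) <= e makes the error strictly less than e. *)
pose d := Num.min 1 (e / (K + 1)).
have d0 : 0 < d by rewrite lt_min ltr01 divr_gt0//; lra.
have d1 : d <= 1 by rewrite ge_min lexx.
have dK : d * (K + 1) <= e by rewrite -ler_pdivlMr ?ge_min ?lexx ?orbT//; lra.
have [s [ssa sE sc]] := npos_approx_sqrt xp d0.
have [t [tsa tE tc]] := npos_approx_sqrt yp d0.
have ys : y * s = s * y by apply: sc.
have st : s * t = t * s by apply: tc.
exists ((s * t) * (s * t)); first by apply/npos_sqr/saM.
have -> : s * t * (s * t) - x * y = d *: (x + y + d *: one).
  rewrite -mulrA (mulrA t) -st -mulrA mulrA sE tE.
  rewrite mulrDr !mulrDl -!real_scaleAr -!real_scaleAl !mulr1 !mul1r.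
  by rewrite -[x * y + _ + _]addrA [LHS]addrC addKr !scalerDr addrCA addrA.
rewrite nrZ gtr0_norm//.
have := nrD (x + y) (d *: one); have := nrD x y; have := @nr_scalar d (ltW d0).
move=> h1 h2 h3; have h : nr (x + y + d *: one) <= K by rewrite /K; lra.
nra.
Qed.

(** The product (t - b) (t + b) = t^2 - b^2 is positive. If s^2 = t^2 - b^2 + e, then |b|^2 <= |b^2
    + s^2| <= t^2 + e. *)
Lemma nr_le_npos b t : 0 <= t ->
  npos (t *: one - b) -> npos (t *: one + b) -> nr b <= t.
Proof.
move=> t0 h1 h2.
have bsa : sa b.
  rewrite (_ : b = t *: one - (t *: one - b)); last by rewrite opprB addrC subrK.
  by apply: saB; [exact: sa_scalar|exact: npos_sa].
suff : nr b ^+ 2 <= t ^+ 2 by rewrite ler_pXn2r// nnegrE nr_ge0.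
apply/ler_addgt0Pr => e e0.
have E : (t *: one - b) * (t *: one + b) = (t ^+ 2) *: one - b * b.
  rewrite mulrDr !mulrBl (scalar_comm t b) addrA subrK.
  by rewrite -real_scaleAl mul1r scalerA -(expr2 t).
have hp : npos ((t ^+ 2) *: one - b * b).
  rewrite -E; apply: nposM => //; rewrite E mulrBr !mulrDl.
  by rewrite (scalar_comm t b) opprD addrA addrK -real_scaleAl mul1r scalerA -(expr2 t).
have [s [ssa sE sc]] := npos_approx_sqrt hp e0.
have bs : b * s = s * b by apply: sc; rewrite mulrBr mulrBl (scalar_comm _ b) mulrA.
rewrite (le_trans (nr_sqr_le bsa ssa bs))// sE addrA [b * b + _]addrC subrK.
by rewrite -scalerDl nr_scalar// addr_ge0 ?sqr_ge0// ltW.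
Qed.

(** With t = |b|, both t - a = (t - b) + (b - a) and t + a are positive. *)
Lemma npos_nr_le a b : npos a -> npos (b - a) -> nr a <= nr b.
Proof.
move=> ap bap; apply: nr_le_npos; first exact: nr_ge0.
  rewrite -(subrKA b); apply: nposD => //; apply: npos_scalarB => //.
  by rewrite -(subrK a b); apply: saD; exact: npos_sa.
by apply: nposD => //; apply: npos_scalar; exact: nr_ge0.
Qed.

(** * Inverses and the spectrum *)

Definition invertible a := exists b, a * b = 1 /\ b * a = 1.

Lemma invertible_lr a l r : l * a = 1 -> a * r = 1 -> invertible a.
Proof.
move=> la ar; exists r; split=> //.
by rewrite -[r]mul1r -la -(mulrA l) ar mulr1 la.
Qed.

Lemma invertibleM a b : invertible a -> invertible b -> invertible (a * b).
Proof.
move=> [x [ax xa]] [y [by' yb]]; apply: (@invertible_lr _ (y * x) (y * x)).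
  by rewrite -mulrA (mulrA x) xa mul1r.
by rewrite -mulrA (mulrA b) by' mul1r.
Qed.

Lemma invertibleZ t a : t != 0 -> invertible a -> invertible (t *: a).
Proof.
move=> t0 [b [ab ba]]; exists (t^-1 *: b).
by rewrite -!real_scaleAl -!real_scaleAr !scalerA mulVf// divff// ab ba scale1r.
Qed.

Lemma invertibleN a : invertible a -> invertible (- a).
Proof. by rewrite -scaleN1r; apply: invertibleZ; rewrite oppr_eq0 oner_eq0. Qed.

Lemma sa_inverse a b : sa a -> a * b = 1 -> b * a = 1 -> sa b.
Proof.
move=> asa ab ba.
by rewrite /sa -[adj b]mulr1 -ab mulrA -{1}asa -adjM ab adj1 mul1r.
Qed.

Lemma npos_invertible a (e : R) : npos a -> 0 < e -> invertible (a + e *: one).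
Proof.
move=> [asa [t ht]] e0.
have t0 : 0 <= t := le_trans (nr_ge0 _) ht.
have te : 0 < t + e by lra.
pose y := (t + e)^-1 *: (t *: one - a).
have [|v vl vr] := @neumann R A y.
  rewrite nrZ ger0_norm ?invr_ge0 1?ltW// mulrC ltr_pdivrMr//; lra.
have -> : a + e *: one = (t + e) *: (1 - y).
  rewrite scalerBr scalerA divff ?gt_eqF// scale1r opprB scalerDl.
  by rewrite addrCA addrAC subrr add0r.
by apply: invertibleZ; [rewrite gt_eqF|exists v].
Qed.

(* With [e] the inverse of [d] and [m > |e|], [m d - 1 = (m - e) d] is a product
   of commuting positive elements. *)
Lemma npos_invertible_ge d : npos d -> invertible d ->
  exists2 t : R, 0 < t & npos (d - t *: one).
Proof.
move=> dp [e [de ed]]; pose m := nr e + 1.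
have m0 : 0 < m by have := nr_ge0 e; rewrite /m; lra.
have esa : sa e := sa_inverse (npos_sa dp) de ed.
exists m^-1; first by rewrite invr_gt0.
have -> : d - m^-1 *: one = m^-1 *: ((m *: one - e) * d).
  by rewrite mulrBl ed -real_scaleAl mul1r scalerBr scalerA mulVf ?scale1r// gt_eqF.
apply: nposZ; first by rewrite invr_ge0 ltW.
apply: nposM => //; first by apply: npos_scalarB => //; rewrite lerDl.
by rewrite mulrBl mulrBr ed de scalar_comm.
Qed.

(** With t = |a| and b = t - a, the claim is that r = |b| is at most t. Otherwise d = r - b = a + (r
    - t) is positive and invertible, so d >= q for some q > 0. Then b stays below r - q, which
    contradicts |b| = r once b is also bounded from below. *)
Lemma npos_spectral a : sa a ->
  (forall e : R, 0 < e -> invertible (a + e *: one)) -> npos a.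
Proof.
move=> asa inv; pose t := nr a; pose b := t *: one - a; pose r := nr b.
have t0 : 0 <= t := nr_ge0 _.
have bsa : sa b by apply: saB => //; exact: sa_scalar.
split=> //; exists t; rewrite leNgt; apply/negP; rewrite -/b -/r => tr.
pose d := r *: one - b.
have dE : d = a + (r - t) *: one.
  by rewrite /d /b scalerBl opprB addrCA.
have dp : npos d by apply: npos_scalarB.
have dinv : invertible d by rewrite dE; apply: inv; lra.
have [q q0 hq] := npos_invertible_ge dp dinv.
(* Capping [q] by [r] keeps r - q' nonnegative. *)
pose q' := Num.min q r.
have q'0 : 0 < q' by rewrite lt_min q0; lra.
have q'q : q' <= q by rewrite ge_min lexx.
have q'r : q' <= r by rewrite ge_min lexx orbT.
suff : nr b <= r - q' by rewrite -/r; lra.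
apply: nr_le_npos; first lra.
  have -> : (r - q') *: one - b = (d - q *: one) + (q - q') *: one.
    by rewrite !scalerBl addrA subrK /d addrAC.
  by apply: nposD => //; apply: npos_scalar; lra.
(* Lower bound: (r - q') + b = (r - q' + t) - a, and |a| = t. *)
rewrite /b addrA -scalerDl; apply: npos_scalarB => //; rewrite -/t; lra.
Qed.

(** By [npos_spectral] it suffices to invert s u s + t = s (u + t e^2) s, where e is the inverse of
    s. Since e^2 is positive and invertible, e^2 >= q > 0, so the middle factor is at least t q and
    invertible. *)
Lemma npos_conj s u : sa s -> invertible s -> npos u -> npos (s * u * s).
Proof.
move=> ssa sinv up; have [e [se es]] := sinv.
have esa : sa e := sa_inverse ssa se es.
apply: npos_spectral; first by rewrite /sa !adjM ssa (npos_sa up) mulrA.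
move=> t t0.
have -> : s * u * s + t *: one = s * (u + t *: (e * e)) * s.
  rewrite mulrDr mulrDl -real_scaleAr -real_scaleAl mulrA se mul1r.
  by rewrite es.
do 2?[apply: invertibleM => //].
have einv : invertible e by exists s.
have [q q0 hq] := npos_invertible_ge (npos_sqr esa) (invertibleM einv einv).
have -> : u + t *: (e * e) = (u + t *: (e * e - q *: one)) + (t * q) *: one.
  by rewrite scalerBr scalerA addrA subrK.
apply: npos_invertible; last exact: mulr_gt0.
by apply: nposD => //; apply: nposZ => //; exact: ltW.
Qed.

(* Testing the norm inequality at [e = (h + eps)^(-1/2)] gives
   [c e g e <= 1], which conjugated by [e^-1] is [c g <= h + eps]. *)
Lemma npos_of_nr_le (h g : B) (c : R) : npos h -> sa g -> 0 <= c ->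
  (forall e, sa e -> c * nr (e * g * e) <= nr (e * h * e)) ->
  npos (h - c *: g).
Proof.
move=> hp gsa c0 le; apply: npos_eps => eps eps0.
have [s [ssa sE sc]] := npos_approx_sqrt hp eps0.
have [q [hq qh]] := npos_invertible hp eps0.
(* If q inverts s^2 = h + eps, then q s and s q are a left and a right inverse of s. *)
have [e [se es]] : invertible s.
  apply: (@invertible_lr _ (q * s) (s * q)).
    by rewrite -mulrA sE.
  by rewrite mulrA sE.
have esa : sa e := sa_inverse ssa se es.
have einv : invertible e by exists s.
have sinv : invertible s by exists e.
have hE : h = s * s - eps *: one by rewrite sE addrK.
have ehe : 1 - e * h * e = eps *: (e * e).
  rewrite {1}hE mulrBr mulrBl mulrA es mul1r se -real_scaleAr -real_scaleAl mulr1.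
  by rewrite opprB addrC subrK.
have nehe : nr (e * h * e) <= 1.
  apply: (le_trans _ (@nr1_le1 R A)); apply: npos_nr_le; first exact: npos_conj.
  by rewrite ehe; apply/nposZ/npos_sqr => //; exact: ltW.
have : npos (1 *: one - c *: (e * g * e)).
  apply: npos_scalarB; first by apply: saZ; rewrite /sa !adjM esa gsa mulrA.
  by rewrite nrZ ger0_norm// (le_trans (le e esa)).
move=> /(npos_conj ssa sinv).
rewrite scale1r mulrBr mulr1 mulrBl -real_scaleAr -real_scaleAl.
by rewrite !mulrA se mul1r -mulrA es mulr1 sE addrAC.
Qed.

(** Forwards, -e lies outside the spectrum for every e > 0, which is the hypothesis of
    [npos_spectral]. Backwards, negative z are excluded by [npos_invertible], and non-real z by the
    computation below. *)
Lemma cstar_positiveE a : cstar_positive (a : A) <-> npos a.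
Proof.
split=> [[asa sp]|ap].
  apply: npos_spectral => // e e0; apply: contrapT => ninv.
  have := sp (- e%:C); rewrite /= oppr_ge0 lecR leNgt e0 => h; apply: notF; apply: h.
  move=> inv; apply: ninv; rewrite -[a + _]opprK; apply: invertibleN.
  rewrite (_ : - (a + e *: one) = (- e%:C *: cunit - (a : A)))//.
  by rewrite opprD addrC scaleNr.
split; first exact: npos_sa.
move=> z /= spz; apply: contrapT => z0; apply: spz.
have [y0|y0] := eqVneq (complex.Im z) 0.
  have x0 : complex.Re z < 0.
    by rewrite ltNge; apply/negP => h; apply: z0; rewrite lecE /= y0 eqxx.
  have -> : z *: cunit - (a : A) = - (a + (- complex.Re z) *: one : B).
    by rewrite opprD addrC scaleNr opprK {1}[z]complexE y0 mulr0 addr0.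
  apply/invertibleN/npos_invertible => //; lra.
(* For z = x + i y with y nonzero, z - a = c + j with c = x - a and j = i y. Both products of c + j
   and c - j equal c^2 + y^2, which is invertible. *)
pose x := complex.Re z; pose y := complex.Im z; pose c := x *: one - a.
pose j := imul (y *: one).
have csa : sa c by apply: saB; [exact: sa_scalar|exact: npos_sa].
have cj : c * j = j * c by rewrite -imulAr -imulAl scalar_comm.
have jj : j * j = - ((y ^+ 2) *: one).
  by rewrite -imulAr -imulAl imulK -real_scaleAl mul1r scalerA -(expr2 y).
have zE : z *: cunit - (a : A) = c + j.
  rewrite /c addrAC; congr (_ - _).
  by rewrite {1}[z]complexE scalerDl -scalerA.
clearbody c j.
have y2 : 0 < y ^+ 2 by rewrite exprn_even_gt0.
have [q [hq qh]] := npos_invertible (npos_sqr csa) y2.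
have E1 : (c + j) * (c - j) = c * c + y ^+ 2 *: one.
  by rewrite mulrDl !mulrBr jj cj opprK addrA subrK.
have E2 : (c - j) * (c + j) = c * c + y ^+ 2 *: one.
  by rewrite mulrBl !mulrDr jj cj opprD opprK addrA addrK.
rewrite zE; apply: (@invertible_lr _ (q * (c - j)) ((c - j) * q)).
  by rewrite -mulrA E2.
by rewrite mulrA E1.
Qed.

End Positive.

(** * Hilbert modules *)

Section Limits.
Context {R : realType} {A : cstarAlgType R}.
Local Notation B := (cstar_ring A).
Implicit Types (u v : nat -> A) (l : A).

Lemma cvg_nrP u l : u @ \oo --> l <->
  forall e : R, 0 < e -> exists N : nat, forall n, (N <= n)%N ->
    nr (u n - l : B) < e.
Proof.
split=> [/cvgrPdist_lt cv e e0|h].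
  have := cv e%:C; rewrite ltcR => /(_ e0) [N _ hN]; exists N => n Nn.
  have := hN n Nn; rewrite /= -[`|_|]/`|(l - u n : B) : A|.
  by rewrite nrE ltcR nrC.
apply/cvgrPdist_lt => e e0.
have eE : e = (complex.Re e)%:C by rewrite RRe_real// gtr0_real.
move: e0; rewrite eE ltcR => /h[N hN]; exists N => // n /= Nn.
by rewrite -[`|_|]/`|(l - u n : B) : A| nrE ltcR nrC hN.
Qed.

Lemma cvg_adherent u l (P : B -> Prop) :
  u @ \oo --> l -> (forall n, P (u n)) -> adherent P l.
Proof.
by move=> /cvg_nrP h Pu e /h[N hN]; exists (u N) => //; apply: hN.
Qed.

Lemma cvg_npos u l : u @ \oo --> l -> (forall n, npos (u n : B)) -> npos (l : B).
Proof. by move=> /cvg_adherent h /h /npos_adherent. Qed.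

Lemma cvg_mulLR u l (a b : B) : u @ \oo --> l ->
  (fun n => a * u n * b : A) @ \oo --> (a * l * b : A).
Proof.
move=> /cvg_nrP h; apply/cvg_nrP => e e0.
pose K := nr a * nr b + 1.
have K0 : 0 < K by rewrite ltr_wpDl// mulr_ge0// nr_ge0.
have [N hN] := h (e / K) (divr_gt0 e0 K0); exists N => n /hN.
rewrite ltr_pdivlMr// => lt; apply: le_lt_trans lt.
rewrite -[X in nr X]/((a * u n * b - a * l * b) : B) -mulrBl -mulrBr.
rewrite (le_trans (nrM _ _))//.
rewrite (le_trans (ler_wpM2r (nr_ge0 _) (nrM _ _)))//.
rewrite mulrAC mulrC ler_wpM2l ?nr_ge0// /K; lra.
Qed.

(** Increments of [u] are positive and below those of [u + v]. The norm is monotone on positive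
    elements, so [u] is Cauchy. *)
Lemma cvg_npos_dominated u v :
  (forall n k, npos (u (n + k)%N - u n : B)) ->
  (forall n k, npos (v (n + k)%N - v n : B)) ->
  cvgn (fun n => u n + v n) -> cvgn u.
Proof.
move=> up vp /cvg_nrP h.
have [e e0|l hl] := @nr_complete R A u.
  have [N hN] := h (e / 2) (divr_gt0 e0 (ltr0Sn R 1)); exists N => k.
  set l : B := lim _ in hN.
  have e1 := hN N (leqnn N); have e2 := hN (N + k)%N (leq_addr _ _).
  pose w n : B := u n + v n.
  have E : w (N + k)%N - w N = (u (N + k)%N - u N : B) + (v (N + k)%N - v N).
    by rewrite /w opprD addrACA.
  apply: (@le_lt_trans _ _ (nr (w (N + k)%N - w N))).
    apply: npos_nr_le; first exact: up.
    by rewrite E addrAC subrr add0r; exact: vp.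
  have := nrD (w (N + k)%N - l) (l - w N); rewrite subrKA (nrC l) => le.
  apply: (le_lt_trans le); rewrite [ltRHS](_ : e = e / 2 + e / 2); last by field.
  exact: ltrD.
by apply/cvg_ex; exists l; apply/cvg_nrP.
Qed.

End Limits.

Section Module.
Context {R : realType} {A : cstarAlgType R} {H : hilbertModType A}.
Local Notation B := (cstar_ring A).
Implicit Types (x y z : H) (a : B) (J : set nat).

Definition ip x y : B := inner x y.

Lemma ipDl x y z : ip (x + y) z = ip x z + ip y z.
Proof.
by have := innerDZl (1 : B) x y z; rewrite scale1r /ip => ->; rewrite cmul1l.
Qed.

Lemma ip0l z : ip 0 z = 0.
Proof. by apply: (addrI (ip 0 z)); rewrite -ipDl !addr0. Qed.

Lemma ipZl a x z : ip (a *: x) z = a * ip x z.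
Proof.
by have := innerDZl a x 0 z; rewrite addr0 -/(ip _ _) => ->; rewrite -/(ip 0 z) ip0l addr0.
Qed.

Lemma ipC x y : ip x y = adj (ip y x). Proof. exact: innerC. Qed.

Lemma ipDr x y z : ip x (y + z) = ip x y + ip x z.
Proof. by rewrite ipC ipDl adjD -!ipC. Qed.

Lemma ipZr a x y : ip x (a *: y) = ip x y * adj a.
Proof. by rewrite ipC ipZl adjM -ipC. Qed.

Lemma ipNl x y : ip (- x) y = - ip x y.
Proof. by apply: (addrI (ip x y)); rewrite -ipDl !subrr ip0l. Qed.

Lemma ipNr x y : ip x (- y) = - ip x y.
Proof. by rewrite ipC ipNl adjN -ipC. Qed.

Lemma npos_ip x : npos (ip x x).
Proof. exact/cstar_positiveE/inner_pos. Qed.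

Lemma parallelogram x y :
  ip (x + y) (x + y) + ip (x - y) (x - y) = 2 *: (ip x x + ip y y).
Proof.
rewrite !ipDl !ipDr !ipNl !ipNr opprK addrACA [X in X + _]addrACA subrr addr0.
rewrite [X in _ + X]addrACA subrr add0r scalerDr.
by rewrite !scaler_nat !mulr2n.
Qed.

Lemma ip_eq0 x : (forall y, ip x y = 0) -> x = 0.
Proof. by move=> h; apply: inner_eq0; apply: h. Qed.

(** Adjointable maps are not assumed linear: having an adjoint forces T (a x) - a T x to be
    orthogonal to every y. *)
Lemma adjointableZ (T : H -> H) a x : adjointable T -> T (a *: x) = a *: T x.
Proof.
move=> [S TS]; apply/subr0_eq/ip_eq0 => y.
by rewrite ipDl ipNl ipZl /ip !TS -!/(ip _ _) ipZl subrr.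
Qed.

Lemma ip_cscale (c : R[i]) x y : ip (Defs.cscale c x) y = c *: inner x y :> A.
Proof.
by rewrite ipZl -[inner x y]cmul1l [RHS]cscaleAl.
Qed.

Lemma ip_cscaler (c : R[i]) x y : ip x (Defs.cscale c y) = Num.conj c *: inner x y :> A.
Proof. by rewrite ipC ip_cscale /adj starZ -innerC. Qed.

Lemma ip_cscale_sqr (c : R[i]) x :
  ip (Defs.cscale c x) (Defs.cscale c x) = complex.Re (`|c| ^+ 2) *: ip x x.
Proof.
rewrite ip_cscale -/(ip _ _) ip_cscaler scalerA -normCK.
rewrite -[RHS]/((complex.Re (`|c| ^+ 2))%:C *: inner x x).
by rewrite RRe_real// rpredX// normr_real.
Qed.

Lemma adjointable0 : adjointable (fun _ : H => 0).
Proof.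
by exists (fun=> 0) => x y; rewrite -!/(ip _ _) ip0l ipC ip0l adj0.
Qed.

Lemma adjointableD (S T : H -> H) :
  adjointable S -> adjointable T -> adjointable (fun x => S x + T x).
Proof.
move=> [S' hS] [T' hT]; exists (fun x => S' x + T' x) => x y.
by rewrite -!/(ip _ _) ipDl ipDr /ip hS hT.
Qed.

Lemma adjointable_cscale (c : R[i]) (T : H -> H) :
  adjointable T -> adjointable (fun x => Defs.cscale c (T x)).
Proof.
move=> [S TS]; exists (fun x => Defs.cscale (Num.conj c) (S x)) => x y.
by rewrite -!/(ip _ _) ip_cscale ip_cscaler conjCK /ip TS.
Qed.

(** Convertible to [square_sums], but with values read in the ring. *)
Definition psum J (y : nat -> H) (n : nat) : B :=
  \sum_(0 <= i < n | i \in J) ip (y i) (y i).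

Lemma psum_incr J (y : nat -> H) n k : npos (psum J y (n + k)%N - psum J y n).
Proof.
elim: k => [|k IH].
  by rewrite addn0 subrr -[0](scale0r (1 : B)); exact: npos_scalar.
rewrite addnS {1}/psum big_mkcond big_nat_recr//= -big_mkcond -/(psum _ _ _) addrAC.
apply: nposD => //; case: ifP => _; first exact: npos_ip.
by rewrite -[0](scale0r (1 : B)); exact: npos_scalar.
Qed.

Lemma npos_psum J (y : nat -> H) n : npos (psum J y n).
Proof.
by have := psum_incr J y 0 n; rewrite add0n /psum [X in _ - X]big_geq// subr0.
Qed.

Lemma npos_square_sum J (y : nat -> H) : ell2 J y -> npos (square_sum J y : B).
Proof. by move=> /cvg_npos; apply=> n; exact: npos_psum. Qed.

Lemma psum_parallelogram J (y z : nat -> H) n :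
  psum J (fun i => y i + z i) n + psum J (fun i => y i - z i) n
  = 2 *: (psum J y n + psum J z n).
Proof.
by rewrite -!big_split /= scaler_sumr; apply: eq_bigr => i _; exact: parallelogram.
Qed.

Lemma cvg_psum J (y : nat -> H) : ell2 J y -> (psum J y : nat -> A) @ \oo --> square_sum J y.
Proof. by []. Qed.

Lemma psumZ J a (y : nat -> H) n :
  psum J (fun i => a *: y i) n = a * psum J y n * adj a.
Proof.
rewrite mulr_sumr mulr_suml; apply: eq_bigr => i _.
by rewrite ipZl ipZr mulrA.
Qed.

Lemma square_sumZ J a (y : nat -> H) : ell2 J y ->
  square_sum J (fun i => a *: y i) = a * square_sum J y * adj a :> B.
Proof.
move=> /cvg_psum /(@cvg_mulLR _ _ _ _ a (adj a)) h; apply: cvg_lim => //.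
by rewrite (_ : square_sums _ _ = fun n => a * psum J y n * adj a)//;
  apply/funext => n; exact: psumZ.
Qed.

(** The partial sums for y + z and y - z both increase, and together they give twice those for y and
    z, which converge. Domination yields convergence, and the gap in the bound is the limit of the
    sums for y - z. *)
Lemma bessel_sum_diff J (y z : nat -> H) : ell2 J y -> ell2 J z ->
  ell2 J (fun i => y i + z i) /\
  npos (2 *: ((square_sum J y : B) + square_sum J z)
        - square_sum J (fun i => y i + z i)).
Proof.
move=> hy hz.
have h : (fun n => psum J (fun i => y i + z i) n + psum J (fun i => y i - z i) n : A)
    @ \oo --> (2%:C *: (square_sum J y + square_sum J z)).
  under eq_fun do rewrite psum_parallelogram.
  exact: cvgZr (cvgD hy hz).
have hs : ell2 J (fun i => y i + z i).
  apply: (@cvg_npos_dominated R A (psum J _) (psum J (fun i => y i - z i))).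
  - exact: psum_incr.
  - exact: psum_incr.
  - by apply/cvg_ex; eexists; exact: h.
split=> //.
apply: (cvg_npos (cvgB h hs)) => n /=.
rewrite -[X in npos X]/(psum J (fun i => y i + z i) n
  + psum J (fun i => y i - z i) n - psum J (fun i => y i + z i) n).
by rewrite addrAC subrr add0r; exact: npos_psum.
Qed.

(** Convergence and upper bound of a frame, separated from the lower bound, which linear
    combinations need not preserve. *)
Definition bessel J (V : nat -> H -> H) := exists2 b : R, 0 < b &
  forall x, ell2 J (V^~ x) /\ npos (b *: ip x x - square_sum J (V^~ x)).

Lemma bessel0 J : bessel J (fun _ _ => 0).
Proof.
exists 1 => // x.
have h : square_sums J (fun=> 0 : H) = (fun=> 0 : A).
  apply/funext => n; rewrite -[LHS]/(psum J _ n); apply: big1 => i _.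
  by rewrite ip0l.
have c0 : square_sums J (fun=> 0 : H) @ \oo --> (0 : A).
  by rewrite h; exact: cvg_cst.
split; first by apply/cvg_ex; exists 0.
rewrite (_ : square_sum _ _ = 0); last exact: cvg_lim c0.
by rewrite subr0 scale1r; exact: npos_ip.
Qed.

Lemma besselD J V W : bessel J V -> bessel J W ->
  bessel J (fun i x => V i x + W i x).
Proof.
move=> [b b0 hV] [c c0 hW]; exists (2 * (b + c)); first lra.
move=> x; have [Vx Vb] := hV x; have [Wx Wb] := hW x.
have [h1 h2] := bessel_sum_diff Vx Wx; split=> //.
pose u : B := square_sum J (V^~ x); pose v : B := square_sum J (W^~ x).
rewrite -(subrKA (2 *: (u + v))); apply: nposD => //.
rewrite -scalerA -scalerBr (scalerDl _ b c) opprD addrACA.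
by apply: nposZ => //; apply: nposD.
Qed.

Lemma bessel_cscale J c V : bessel J V -> bessel J (fun i x => Defs.cscale c (V i x)).
Proof.
move=> [b b0 hV]; pose t := complex.Re (`|c| ^+ 2).
have t0 : 0 <= t.
  by rewrite -ler0c RRe_real ?exprn_ge0// rpredX// normr_real.
(* The added 1 keeps the bound positive when c = 0. *)
exists (t * b + 1); first by rewrite ltr_wpDl// mulr_ge0// ltW.
move=> x; have [Vx Vb] := hV x.
have h : (square_sums J (fun i => Defs.cscale c (V i x))) @ \oo -->
    (t%:C *: square_sum J (V^~ x)).
  rewrite (_ : square_sums _ _ = fun n => t%:C *: square_sums J (V^~ x) n).
    exact: cvgZr Vx.
  apply/funext => n; rewrite -[LHS]/(psum J _ n).
  rewrite -[RHS]/(t *: psum J _ n) scaler_sumr.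
  by apply: eq_bigr => i _; rewrite ip_cscale_sqr.
split; first by apply/cvg_ex; eexists; exact: h.
rewrite (_ : square_sum _ _ = t *: (square_sum J (V^~ x) : B)); last exact: cvg_lim h.
rewrite scalerDl scale1r addrAC -scalerA -scalerBr.
by apply: nposD; [exact: nposZ|exact: npos_ip].
Qed.

Lemma sqrtC_real (t : R) : 0 <= t -> sqrtC t%:C = (Num.sqrt t)%:C.
Proof.
move=> t0; rewrite -{1}(sqr_sqrtr t0) rmorphXn /= sqrCK//.
by rewrite ler0c sqrtr_ge0.
Qed.

(** Squaring puts the hypothesis of the theorem in the form needed by [npos_of_nr_le], and lambda
    enters as lambda^2. *)
Lemma ell2_norm_le J (lambda : R) (y z : nat -> H) : 0 < lambda ->
  (lambda%:C * ell2_norm J y <= ell2_norm J z) =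
  (lambda ^+ 2 * nr (square_sum J y) <= nr (square_sum J z)).
Proof.
move=> l0; rewrite /ell2_norm !nrE !sqrtC_real ?nr_ge0// -rmorphM /= lecR.
rewrite -[in LHS](ger0_norm (ltW l0)) -sqrtr_sqr -sqrtrM ?sqr_ge0//.
by rewrite ler_sqrt ?nr_ge0.
Qed.

Lemma lin_comb_adjointable k (alpha : 'I_k -> R[i]) (T : 'I_k -> nat -> H -> H) i :
  (forall n, adjointable (T n i)) -> adjointable (lin_comb alpha T i).
Proof.
move=> hT; rewrite /lin_comb; elim: (index_enum _) => [|n s IH].
  by under eq_fun do rewrite big_nil; exact: adjointable0.
under eq_fun do rewrite big_cons.
by apply: adjointableD => //; exact: adjointable_cscale.
Qed.

Lemma lin_comb_bessel J k (alpha : 'I_k -> R[i]) (T : 'I_k -> nat -> H -> H) :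
  (forall n, bessel J (T n)) -> bessel J (lin_comb alpha T).
Proof.
move=> hT; rewrite /lin_comb; elim: (index_enum _) => [|n s IH].
  rewrite (_ : (fun _ => _) = (fun _ _ => 0)); first exact: bessel0.
  by apply/funext => i; apply/funext => x; rewrite big_nil.
rewrite (_ : (fun _ => _) = (fun i x => Defs.cscale (alpha n) (T n i x)
    + \sum_(m <- s) Defs.cscale (alpha m) (T m i x))).
  by apply: besselD => //; exact: bessel_cscale.
by apply/funext => i; apply/funext => x; rewrite big_cons.
Qed.

Lemma cstar_leE (a b : A) : cstar_le a b <-> npos (b - a : B).
Proof. exact: cstar_positiveE. Qed.

End Module.

Theorem theorem3p8 (R : realType) (A : cstarAlgType R) (H : hilbertModType A)
    (J : set nat) (k : nat) (k_gt0 : (0 < k)%N)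
    (T : 'I_k -> nat -> H -> H) (a b : 'I_k -> R)
    (frameT : forall n : 'I_k, operator_frame_with J (T n) (a n) (b n))
    (alpha : 'I_k -> R[i]) :
  (exists lambda : R, 0 < lambda /\ exists p : 'I_k, forall x : H,
     lambda%:C * ell2_norm J (fun i => T p i x)
       <= ell2_norm J (fun i => lin_comb alpha T i x))
  <-> operator_frame J (lin_comb alpha T).
Proof.
split=> [[lambda [l0 [p le]]]|[c [d [c0 d0 _ hS]]]].
  have adjS i : J i -> adjointable (lin_comb alpha T i).
    by move=> Ji; apply: lin_comb_adjointable => n; have [_ _ h _] := frameT n; apply: h.
  have [d d0 hS] : bessel J (lin_comb alpha T).
    apply: lin_comb_bessel => n; have [_ bn _ h] := frameT n.
    by exists (b n) => // x; have [h1 _ /cstar_leE h3] := h x.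
  have [a0 b0 _ hT] := frameT p.
  exists (lambda ^+ 2 * a p), d; split=> //; first by rewrite mulr_gt0// exprn_gt0.
  move=> x; have [S1 S2] := hS x; split=> //; last exact/cstar_leE.
  apply/cstar_leE; apply: npos_of_nr_le.
  - exact: npos_square_sum.
  - exact/npos_sa/npos_ip.
  - by rewrite mulr_ge0 ?sqr_ge0// ltW.
  move=> e esa.
  have -> : e * ip x x * e = ip (e *: x) (e *: x) by rewrite ipZl ipZr esa mulrA.
  (* Each operator with index in [J] is adjointable, so e moves inside it. *)
  have -> : e * square_sum J (fun i => lin_comb alpha T i x) * e
     = square_sum J (fun i => lin_comb alpha T i (e *: x)).
    rewrite -{2}esa -square_sumZ//; congr (limn _ : A).
    apply/funext => n; apply: eq_bigr => i; rewrite inE => Ji.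
    by rewrite adjointableZ//; exact: adjS.
  (* It remains to see a_p |<ex, ex>| <= |sum_i <T_{p,i} ex, T_{p,i} ex>|, which is the lower frame
     bound of T_p in norm. *)
  have := le (e *: x); rewrite ell2_norm_le//; apply: le_trans.
  rewrite -mulrA ler_wpM2l ?sqr_ge0//.
  have [_ /cstar_leE h _] := hT (e *: x).
  rewrite -[leLHS](_ : nr (a p *: ip (e *: x) (e *: x)) = _); last first.
    by rewrite nrZ gtr0_norm.
  apply: npos_nr_le => //; apply: nposZ; [exact: ltW|exact: npos_ip].
(* Any index would do; the first is taken. From |sum_i <T_{p,i} x, T_{p,i} x>| <= b_p |<x, x>| and c
   |<x, x>| <= |sum_i <S_i x, S_i x>| one reads off lambda^2 = c / b_p. *)
pose p := Ordinal k_gt0; have [_ b0 _ hT] := frameT p.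
exists (Num.sqrt (c / b p)); split; first by rewrite sqrtr_gt0 divr_gt0.
exists p => x; rewrite ell2_norm_le ?sqrtr_gt0 ?divr_gt0//.
rewrite sqr_sqrtr ?(divr_ge0 (ltW c0) (ltW b0))//.
have [T1 _ /cstar_leE T2] := hT x; have [S1 /cstar_leE S2 _] := hS x.
have hT' := npos_nr_le (npos_square_sum T1) T2.
have hS' := npos_nr_le (nposZ (ltW c0) (npos_ip x)) S2.
have E s : 0 < s -> nr (s%:C *: inner x x : A) = s * nr (ip x x).
  by move=> s0; rewrite -[X in nr X]/(s *: ip x x) nrZ gtr0_norm.
move: hT'; rewrite E// => hT'; apply: le_trans hS'.
rewrite nrZ gtr0_norm// mulrAC ler_pdivrMr// -mulrA ler_pM2l//.
by rewrite mulrC.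
Qed.
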